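(* Let $R=k[[x_1,\dots,x_n]]$ and let $I,J\subset R$ be ideals. Assume there exists an isomorphism of $k$-algebras $\phi:R\to R$ such that $\phi(I)=J$. Then for every integer $m\ge 1$, $\phi$ induces an isomorphism $R/I^{m\text{-}jsc}\cong R/J^{m\text{-}jsc}$.
   Context: $k$ is an algebraically closed field of characteristic $0$, and $\mathfrak m$ is the maximal ideal of $R$. For an integer $m\ge 0$ put $P_m=k[x_i^{(j)}: 1\le i\le n,\ 1\le j\le m]$. For $g\in R$ define $D_0(g),\dots,D_m(g)\in P_m$ by $$g\Big(\sum_{j=1}^m x_1^{(j)}t^j,\dots,\sum_{j=1}^m x_n^{(j)}t^j\Big)\equiv\sum_{j=0}^m D_j(g)\,t^j \pmod{t^{m+1}}.$$ For an ideal $I\subset R$ let $\overline{I}_m\subset P_m$ be the ideal generated by all $D_j(g)$ with $g\in I$, $0\le j\le m$. (Here $P_m$ is the $m$-th jet ring $R_m$ modulo $\mathfrak m R_m$, and $\overline I_m$ is the image of the $m$-th jet ideal of $I$.) The $m$-th jet support closure of $I$ is $$I^{m\text{-}jsc}=\Big\{f\in R: D_j(f)\in \sqrt{\overline I_m} \text{ for all } 0\le j\le m\Big\}.$$ *)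

(* Defs.v *)
From HB Require Import structures.
From mathcomp Require Import all_boot all_order all_algebra.
From mathcomp Require Import generic_quotient ring_quotient boolp mpoly.

Set Implicit Arguments.
Unset Strict Implicit.
Unset Printing Implicit Defensive.

Import GRing.Theory.
Local Open Scope ring_scope.
Local Open Scope quotient_scope.

(* Ideals of a commutative ring, as boolean predicates (no loss of generality
   with the classical axioms of boolp). Unlike [idealr] of ring_quotient, the
   unit ideal is allowed: it does occur as a jet support closure. *)

HB.mixin Record isMulAbsorbing (A : comNzRingType) (S : A -> bool) := {
  mul_absorbing_subproof : forall a, {in S, forall u, a * u \in S}
}.

#[short(type="idealType")]
HB.structure Definition Ideal (A : comNzRingType) :=
  {S of GRing.ZmodClosed A S & isMulAbsorbing A S}.

Section IdealTheory.
Variables (A : comNzRingType) (I : idealType A).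

Lemma ideal_mulr a u : u \in (I : {pred A}) -> a * u \in (I : {pred A}).
Proof. exact: mul_absorbing_subproof. Qed.

Lemma ideal_mull a u : u \in (I : {pred A}) -> u * a \in (I : {pred A}).
Proof. by rewrite mulrC; apply: ideal_mulr. Qed.

End IdealTheory.

(* The quotient algebra A / I, possibly zero: it carries a commutative ring
   structure and a K-module structure (MathComp's algebra structures are
   restricted to nonzero rings). *)

Section QuotientAlgebra.
Variables (K : comNzRingType) (A : comAlgType K) (I : idealType A).

Definition quot_alg := Quotient.quot I.

HB.instance Definition _ := Choice.on quot_alg.
HB.instance Definition _ := EqQuotient.copy quot_alg (Quotient.quot I).
HB.instance Definition _ := GRing.Zmodule.copy quot_alg (Quotient.quot I).

Definition quot_pi (x : A) : quot_alg := \pi_quot_alg x.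

Lemma quot_algP (x y : A) :
  reflect (quot_pi x = quot_pi y) (x - y \in (I : {pred A})).
Proof. by rewrite Quotient.idealrBE; apply: eqP. Qed.

Lemma quot_reprK (x : quot_alg) : quot_pi (repr x) = x.
Proof. exact: reprK. Qed.

Lemma quot_piB : {morph quot_pi : x y / x - y >-> x - y}.
Proof. exact: (raddfB \pi_(Quotient.quot I)). Qed.

Lemma quot_piD : {morph quot_pi : x y / x + y >-> x + y}.
Proof. exact: (raddfD \pi_(Quotient.quot I)). Qed.

Definition quot_alg_one : quot_alg := \pi_quot_alg 1.
Definition quot_alg_mul (x y : quot_alg) : quot_alg :=
  \pi_quot_alg (repr x * repr y).
Definition quot_alg_scale (c : K) (x : quot_alg) : quot_alg :=
  \pi_quot_alg (c *: repr x).

Lemma quot_piM : {morph quot_pi : x y / x * y >-> quot_alg_mul x y}.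
Proof.
move=> x y; apply/quot_algP.
have h z : z - repr (quot_pi z) \in (I : {pred A}).
  by apply/quot_algP; rewrite quot_reprK.
have -> : x * y - repr (quot_pi x) * repr (quot_pi y)
    = x * (y - repr (quot_pi y)) + repr (quot_pi y) * (x - repr (quot_pi x)).
  by rewrite !mulrBr [X in _ + (X - _)]mulrC addrA subrK [X in _ - X = _]mulrC.
by apply: rpredD; apply: ideal_mulr.
Qed.

Lemma quot_piZ c : {morph quot_pi : x / c *: x >-> quot_alg_scale c x}.
Proof.
move=> x; apply/quot_algP.
rewrite -scalerBr -[_ - _]mul1r scalerAl ideal_mulr //.
by apply/quot_algP; rewrite quot_reprK.
Qed.

Fact quot_alg_mulA : associative quot_alg_mul.
Proof.
move=> x y z; rewrite -(quot_reprK x) -(quot_reprK y) -(quot_reprK z).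
by rewrite -!quot_piM mulrA.
Qed.

Fact quot_alg_mulC : commutative quot_alg_mul.
Proof. by move=> x y; rewrite /quot_alg_mul mulrC. Qed.

Fact quot_alg_mul1 : left_id quot_alg_one quot_alg_mul.
Proof. by move=> x; rewrite -(quot_reprK x) -quot_piM mul1r. Qed.

Fact quot_alg_mulDl : left_distributive quot_alg_mul +%R.
Proof.
move=> x y z; rewrite -(quot_reprK x) -(quot_reprK y) -(quot_reprK z).
by rewrite -quot_piD -!quot_piM -quot_piD mulrDl.
Qed.

HB.instance Definition _ := GRing.Zmodule_isComPzRing.Build quot_alg
  quot_alg_mulA quot_alg_mulC quot_alg_mul1 quot_alg_mulDl.

Fact quot_pi_monoid_morphism : monoid_morphism quot_pi.
Proof. by split=> [//|x y]; apply: quot_piM. Qed.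

HB.instance Definition _ := GRing.isZmodMorphism.Build A quot_alg quot_pi
  quot_piB.
HB.instance Definition _ := GRing.isMonoidMorphism.Build A quot_alg quot_pi
  quot_pi_monoid_morphism.

Fact quot_alg_scaleA a b x :
  quot_alg_scale a (quot_alg_scale b x) = quot_alg_scale (a * b) x.
Proof. by rewrite -(quot_reprK x) -!quot_piZ scalerA. Qed.

Fact quot_alg_scale1 : left_id 1 quot_alg_scale.
Proof. by move=> x; rewrite -(quot_reprK x) -!quot_piZ scale1r. Qed.

Fact quot_alg_scaleDr : right_distributive quot_alg_scale +%R.
Proof.
move=> c x y; rewrite -(quot_reprK x) -(quot_reprK y).
by rewrite -quot_piD -!quot_piZ -quot_piD scalerDr.
Qed.

Fact quot_alg_scaleDl x : {morph quot_alg_scale^~ x : a b / a + b}.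
Proof.
by move=> a b; rewrite -(quot_reprK x) -!quot_piZ -quot_piD scalerDl.
Qed.

HB.instance Definition _ := GRing.Zmodule_isLmodule.Build K quot_alg
  quot_alg_scaleA quot_alg_scale1 quot_alg_scaleDr quot_alg_scaleDl.

HB.instance Definition _ := GRing.isScalable.Build K A quot_alg *:%R quot_pi
  quot_piZ.

End QuotientAlgebra.

Section GeneratedIdeal.
Variable A : comNzRingType.

Definition ideal_gen (G : A -> Prop) : A -> bool := fun x =>
  `[< exists2 s : seq (A * A), forall c, c \in s -> G c.2
      & x = \sum_(c <- s) c.1 * c.2 >].

Fact ideal_gen_zmod_closed G : zmod_closed (ideal_gen G).
Proof.
split=> [|x y /asboolP[s sG ->] /asboolP[t tG ->]]; apply/asboolP.
  by exists [::]; rewrite ?big_nil.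
exists (s ++ [seq (- c.1, c.2) | c <- t]).
  move=> c; rewrite mem_cat => /orP[/sG//|/mapP[d /tG dG ->]]; exact: dG.
rewrite big_cat big_map -sumrN /=; congr (_ + _).
by apply: eq_bigr => c _; rewrite mulNr.
Qed.

HB.instance Definition _ G := GRing.isZmodClosed.Build A (ideal_gen G)
  (ideal_gen_zmod_closed G).

Fact ideal_gen_absorbing G a : {in ideal_gen G, forall u, a * u \in ideal_gen G}.
Proof.
move=> x /asboolP[s sG ->]; apply/asboolP.
exists [seq (a * c.1, c.2) | c <- s].
  by move=> c /mapP[d /sG dG ->].
by rewrite big_map mulr_sumr; apply: eq_bigr => c _; rewrite mulrA.
Qed.

HB.instance Definition _ G := isMulAbsorbing.Build A (ideal_gen G)
  (@ideal_gen_absorbing G).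

Definition radical (I : {pred A}) : A -> bool := fun x =>
  `[< exists e : nat, x ^+ e \in I >].

Section RadicalOfIdeal.
Variable I : idealType A.

Fact radical_zmod_closed : zmod_closed (radical I).
Proof.
split=> [|x y /asboolP[a xI] /asboolP[b yI]]; apply/asboolP.
  by exists 1%N; rewrite expr1 rpred0.
exists (a + b)%N; rewrite exprDn; apply: rpred_sum => i _; apply: rpredMn.
case: (leqP b i) => [bi|ib].
  apply: ideal_mulr; rewrite exprNn; apply: ideal_mulr.
  by rewrite -(subnK bi) exprD ideal_mulr.
apply: ideal_mull; have ai : (a <= a + b - i)%N.
  by rewrite -addnBA ?leq_addr // ltnW.
by rewrite -(subnK ai) exprD ideal_mulr.
Qed.

HB.instance Definition _ := GRing.isZmodClosed.Build A (radical I)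
  radical_zmod_closed.

Fact radical_absorbing a : {in radical I, forall u, a * u \in radical I}.
Proof.
move=> x /asboolP[e xI]; apply/asboolP.
by exists e; rewrite exprMn ideal_mulr.
Qed.

HB.instance Definition _ := isMulAbsorbing.Build A (radical I)
  radical_absorbing.

End RadicalOfIdeal.
End GeneratedIdeal.

Record fps (n : nat) (R : Type) := Fps { fps_coef :> 'X_{1..n} -> R }.

HB.instance Definition _ n (R : Type) := gen_eqMixin (fps n R).
HB.instance Definition _ n (R : Type) := gen_choiceMixin (fps n R).

Lemma fpsP n (R : Type) (f g : fps n R) : f =1 g <-> f = g.
Proof.
split=> [|-> //]; case: f g => [f] [g] /= fg.
by congr Fps; apply/funext.
Qed.

Section FpsAlgebra.
Variables (n : nat) (R : comNzRingType).
Implicit Types (f g h : fps n R) (mu : 'X_{1..n}).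

Definition fps0 : fps n R := Fps (fun=> 0).
Definition fps1 : fps n R := Fps (fun mu => (mu == 0%MM)%:R).
Definition fps_opp f : fps n R := Fps (fun mu => - f mu).
Definition fps_add f g : fps n R := Fps (fun mu => f mu + g mu).
Definition fps_scale (c : R) f : fps n R := Fps (fun mu => c * f mu).
Definition fps_mul f g : fps n R := Fps (fun mu =>
  \sum_(a : 'X_{1..n < (mdeg mu).+1, (mdeg mu).+1} | mu == (a.1 + a.2)%MM)
     f a.1 * g a.2).

Fact fps_addA : associative fps_add.
Proof. by move=> f g h; apply/fpsP => mu /=; rewrite addrA. Qed.
Fact fps_addC : commutative fps_add.
Proof. by move=> f g; apply/fpsP => mu /=; rewrite addrC. Qed.
Fact fps_add0 : left_id fps0 fps_add.
Proof. by move=> f; apply/fpsP => mu /=; rewrite add0r. Qed.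
Fact fps_addN : left_inverse fps0 fps_opp fps_add.
Proof. by move=> f; apply/fpsP => mu /=; rewrite addNr. Qed.

HB.instance Definition _ := GRing.isZmodule.Build (fps n R)
  fps_addA fps_addC fps_add0 fps_addN.

(* The sum of the terms of degree less than b. *)
Definition fps_trunc (b : nat) f : {mpoly R[n]} :=
  \sum_(mu : 'X_{1..n < b}) f mu *: 'X_[mu].

Lemma mcoeff_trunc b f mu :
  (fps_trunc b f)@_mu = if (mdeg mu < b)%N then f mu else 0.
Proof.
rewrite /fps_trunc raddf_sum /=; case: ltnP => hb.
  rewrite (bigD1 (BMultinom hb)) //= mcoeffZ mcoeffX eqxx mulr1.
  rewrite big1 ?addr0 // => nu; rewrite bmeqP /= => nu_mu.
  by rewrite mcoeffZ mcoeffX (negPf nu_mu) mulr0.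
rewrite big1 // => nu _; rewrite mcoeffZ mcoeffX.
case: eqP => [E|_]; rewrite ?mulr0 //.
by move: (bmdeg nu); rewrite E ltnNge hb.
Qed.

(* Coefficients of a product only depend on the terms of no larger degree. *)
Lemma eq_mcoeffM b (p q p' q' : {mpoly R[n]}) mu : (mdeg mu < b)%N ->
    (forall nu, (mdeg nu < b)%N -> p@_nu = p'@_nu) ->
    (forall nu, (mdeg nu < b)%N -> q@_nu = q'@_nu) ->
  (p * q)@_mu = (p' * q')@_mu.
Proof.
move=> hb hp hq; rewrite !mcoeffM; apply: eq_bigr => a _.
by rewrite hp ?hq //; apply: leq_trans (bmdeg _) hb.
Qed.

Lemma fps_mulE b f g mu : (mdeg mu < b)%N ->
  fps_mul f g mu = (fps_trunc b f * fps_trunc b g)@_mu.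
Proof.
move=> hb; rewrite mcoeffM /=; apply: eq_bigr => a _.
have h1 := leq_trans (bmdeg a.1) hb; have h2 := leq_trans (bmdeg a.2) hb.
by rewrite !mcoeff_trunc h1 h2.
Qed.

Lemma mcoeff_truncM b f g mu : (mdeg mu < b)%N ->
  (fps_trunc b (fps_mul f g))@_mu = (fps_trunc b f * fps_trunc b g)@_mu.
Proof. by move=> hb; rewrite mcoeff_trunc hb (fps_mulE _ _ hb). Qed.

Fact fps_mulA : associative fps_mul.
Proof.
move=> f g h; apply/fpsP => mu; rewrite !(fps_mulE _ _ (ltnSn (mdeg mu))).
transitivity (fps_trunc (mdeg mu).+1 f *
    (fps_trunc (mdeg mu).+1 g * fps_trunc (mdeg mu).+1 h))@_mu.
  by apply: eq_mcoeffM (ltnSn _) _ _ => // nu; apply: mcoeff_truncM.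
rewrite mulrA; apply: eq_mcoeffM (ltnSn _) _ _ => // nu hb.
by rewrite mcoeff_truncM.
Qed.

Fact fps_mulC : commutative fps_mul.
Proof.
move=> f g; apply/fpsP => mu.
by rewrite !(fps_mulE _ _ (ltnSn (mdeg mu))) mulrC.
Qed.

Fact fps_mul1 : left_id fps1 fps_mul.
Proof.
move=> f; apply/fpsP => mu; rewrite (fps_mulE _ _ (ltnSn (mdeg mu))).
have -> : fps_trunc (mdeg mu).+1 fps1 = 1.
  apply/mpolyP => nu; rewrite mcoeff_trunc mcoeff1 /=.
  by case: eqP => [->|_]; rewrite ?mdeg0 //; case: ifP.
by rewrite mul1r mcoeff_trunc ltnSn.
Qed.

Fact fps_mulDl : left_distributive fps_mul +%R.
Proof.
move=> f g h; apply/fpsP => mu /=.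
by rewrite -big_split /=; apply: eq_bigr => a _; rewrite mulrDl.
Qed.

Fact fps_oner_neq0 : fps1 != 0.
Proof.
by apply/eqP => /fpsP/(_ 0%MM) /eqP; rewrite /= eqxx oner_eq0.
Qed.

HB.instance Definition _ := GRing.Zmodule_isComNzRing.Build (fps n R)
  fps_mulA fps_mulC fps_mul1 fps_mulDl fps_oner_neq0.

Fact fps_scaleA a b f : fps_scale a (fps_scale b f) = fps_scale (a * b) f.
Proof. by apply/fpsP => mu /=; rewrite mulrA. Qed.
Fact fps_scale1 : left_id 1 fps_scale.
Proof. by move=> f; apply/fpsP => mu /=; rewrite mul1r. Qed.
Fact fps_scaleDr : right_distributive fps_scale +%R.
Proof. by move=> c f g; apply/fpsP => mu /=; rewrite mulrDr. Qed.
Fact fps_scaleDl f : {morph fps_scale^~ f : a b / a + b}.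
Proof. by move=> a b; apply/fpsP => mu /=; rewrite mulrDl. Qed.

HB.instance Definition _ := GRing.Zmodule_isLmodule.Build R (fps n R)
  fps_scaleA fps_scale1 fps_scaleDr fps_scaleDl.

Fact fps_scaleAl (c : R) f g : c *: (f * g) = (c *: f) * g.
Proof.
apply/fpsP => mu /=; rewrite mulr_sumr.
by apply: eq_bigr => a _; rewrite mulrA.
Qed.

HB.instance Definition _ := GRing.Lmodule_isLalgebra.Build R (fps n R)
  fps_scaleAl.
HB.instance Definition _ := GRing.Lalgebra_isComAlgebra.Build R (fps n R).

End FpsAlgebra.

Section Jets.
Variables (n : nat) (k : comNzRingType) (m : nat).

(* P_m; its variables are enumerated by [mxvec_index : 'I_n -> 'I_m -> _]. *)
Definition jet_ring := {mpoly k[n * m]}.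

(* The variable x_i^(j), where j : 'I_m stands for the exponent j.+1. *)
Definition jet_var (i : 'I_n) (j : 'I_m) : jet_ring :=
  'X_(mxvec_index i j).

Definition jet_arc (i : 'I_n) : {poly jet_ring} :=
  \sum_(j < m) jet_var i j *: 'X^(j.+1).

(* g evaluated at the arcs, modulo 'X^m.+1: since the arcs have no constant
   term, the terms of g of degree greater than m do not contribute. *)
Definition jet_eval (g : fps n k) : {poly jet_ring} :=
  mmap (polyC \o @mpolyC (n * m) k) jet_arc (fps_trunc m.+1 g).

(* Only meaningful for j <= m. *)
Definition jetD (j : nat) (g : fps n k) : jet_ring := (jet_eval g)`_j.

Definition jet_ideal (I : {pred fps n k}) : jet_ring -> bool :=
  ideal_gen (fun p => exists g j, [/\ g \in I, (j <= m)%N & p = jetD j g]).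

HB.instance Definition _ I := Ideal.copy (jet_ideal I)
  (ideal_gen (fun p => exists g j, [/\ g \in I, (j <= m)%N & p = jetD j g])).

Definition jsc_pred (I : {pred fps n k}) : fps n k -> bool := fun f =>
  `[< forall j, (j <= m)%N -> jetD j f \in radical (jet_ideal I) >].

Lemma jetDB j : {morph jetD j : f g / f - g}.
Proof.
move=> f g; rewrite /jetD -coefB /jet_eval -rmorphB.
suff -> : fps_trunc m.+1 (f - g) = fps_trunc m.+1 f - fps_trunc m.+1 g by [].
apply/mpolyP => mu; rewrite mcoeffB !mcoeff_trunc.
by case: ifP; rewrite ?subr0.
Qed.

Lemma jetD0 j : jetD j 0 = 0.
Proof. by rewrite -(subrr 0) jetDB subrr. Qed.

Lemma coef_mmap1_arc (mu : 'X_{1..n}) j : (j < mdeg mu)%N ->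
  (mmap1 jet_arc mu)`_j = 0.
Proof.
have E i : jet_arc i = (\sum_(l < m) jet_var i l *: 'X^l) * 'X.
  by rewrite mulr_suml; apply: eq_bigr => l _; rewrite exprSr scalerAl.
have -> : mmap1 jet_arc mu =
    \prod_i (\sum_(l < m) jet_var i l *: 'X^l) ^+ mu i * 'X^(mdeg mu).
  rewrite mdegE -prodrXr -big_split; apply: eq_bigr => i _.
  by rewrite E exprMn.
by rewrite coefMXn => ->.
Qed.

Lemma jetDM j (f g : fps n k) : (j <= m)%N ->
  jetD j (f * g) = \sum_(i < j.+1) jetD i f * jetD (j - i) g.
Proof.
move=> jm; rewrite -coefM /jetD /jet_eval -rmorphM.
apply/eqP; rewrite -subr_eq0 -coefB -rmorphB; apply/eqP.
rewrite /mmap coef_sum big_seq big1 // => mu.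
rewrite mcoeff_msupp mcoeffB => nz.
case: (ltnP (mdeg mu) m.+1) nz => [lt_mu|le_mu _].
  by rewrite mcoeff_truncM // subrr eqxx.
by rewrite /= coefCM coef_mmap1_arc ?mulr0 // (leq_ltn_trans jm).
Qed.

Section JscIdeal.
Variable I : {pred fps n k}.

Fact jsc_zmod_closed : zmod_closed (jsc_pred I).
Proof.
split=> [|f g /asboolP fI /asboolP gI]; apply/asboolP => j jm.
  by rewrite jetD0 rpred0.
by rewrite jetDB; apply: rpredB; [exact: fI | exact: gI].
Qed.

HB.instance Definition _ := GRing.isZmodClosed.Build (fps n k) (jsc_pred I)
  jsc_zmod_closed.

Fact jsc_absorbing a : {in jsc_pred I, forall f, a * f \in jsc_pred I}.
Proof.
move=> f /asboolP fI; apply/asboolP => j jm; rewrite jetDM //.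
apply: rpred_sum => i _; apply: ideal_mulr; apply: fI.
by rewrite (leq_trans _ jm) // leq_subr.
Qed.

HB.instance Definition _ := isMulAbsorbing.Build (fps n k) (jsc_pred I)
  jsc_absorbing.

(* The m-th jet support closure. *)
Definition jsc : idealType (fps n k) := Ideal.clone (fps n k) (jsc_pred I) _.

End JscIdeal.
End Jets.

Arguments jet_arc {n} k m i.
Arguments jet_ideal {n k} m I.

(* Main.v *)
Require Import Defs.
From HB Require Import structures.
From mathcomp Require Import all_boot all_order all_algebra.
From mathcomp Require Import boolp mpoly.

Set Implicit Arguments.
Unset Strict Implicit.
Unset Printing Implicit Defensive.

Import GRing.Theory.
Local Open Scope ring_scope.

(** Jets are functorial. A point of the m-th jet scheme over the origin is an
    arc modulo t^(m+1) starting at the origin, and an endomorphism [phi] of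
    k[[x_1, ..., x_n]] acts on such arcs by substitution, provided that it
    sends every variable to a series without constant term. On coordinate
    rings this action is the substitution [jet_map], which replaces x_i^(j) by
    D_j (phi x_i), and it satisfies

      jet_map (D_j g) = D_j (phi g)   for all series g and all j <= m

    ([jet_mapD]). Hence [jet_map] carries the generators of the jet ideal of I
    to jet coefficients of phi(I), and being a ring morphism it carries powers
    to powers; so phi maps the jet support closure of I into that of any J
    containing phi(I) ([jsc_endo]). For an isomorphism with phi(I) = J the
    same applies to the inverse of phi, and the two maps induced on the
    quotients are inverse to each other.

    Two points need an argument. First, phi is not assumed to be local, but it
    is ([endo_fpsX_const]): if phi x_i had a constant term c <> 0, then the
    unit 1 - x_i / c would be sent to a series without constant term.

    Second, phi is not assumed to be continuous either, so the displayed
    identity cannot be checked on monomials and extended to infinite sums. It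
    is proved for all series at once by induction on j: write
    g = g(0) + sum_i x_i g_i ([fps_decomp]) and apply the Leibniz rule. Since
    D_0 x_i and D_0 (phi x_i) vanish, only the D_l g_i with l < j enter in
    D_j g, and only the D_l (phi g_i) with l < j in D_j (phi g). *)

Section PowerSeriesVariables.
Variables (n : nat) (R : comNzRingType).
Implicit Types (f g : fps n R) (mu nu : 'X_{1..n}) (i : 'I_n).

Definition fpsX i : fps n R := Fps (fun mu => (mu == U_(i)%MM)%:R).

Lemma coef_fpsXM i f mu :
  (fpsX i * f) mu = if mu i == 0%N then 0 else f (mu - U_(i))%MM.
Proof.
case: eqP => [mui0|/eqP mui0].
  apply: big1 => -[a b] /= /eqP Emu; case: eqP => [Ea|_]; last by rewrite mul0r.
  by have := mnmDE i a b; rewrite -Emu mui0 Ea mnm1E eqxx.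
have Emu : mu = (U_(i) + (mu - U_(i)))%MM.
  by rewrite addmC submK // lep1mP.
rewrite [LHS](fps_mulE _ _ (ltnSn (mdeg mu))).
transitivity ('X_[U_(i)] * fps_trunc (mdeg mu).+1 f)@_mu.
  apply: eq_mcoeffM (ltnSn _) _ _ => // nu hnu.
  by rewrite mcoeff_trunc hnu mcoeffX eq_sym.
have := mcoeffMX (fps_trunc (mdeg mu).+1 f) U_(i) (mu - U_(i)).
rewrite -Emu mulrC => ->; rewrite mcoeff_trunc.
by have := mdegD U_(i) (mu - U_(i)); rewrite -Emu mdeg1 => ->; rewrite leqW.
Qed.

(** The quotients in [fps_decomp]: to account for every nonconstant monomial
    exactly once, it is attributed to the variable that [pick] selects among
    those dividing it, and [fps_tail i f] collects the monomials attributed to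
    x_i, divided by x_i. *)
Definition fps_tail i f : fps n R := Fps (fun nu =>
  if [pick l | (nu + U_(i))%MM l != 0%N] == Some i then f (nu + U_(i))%MM
  else 0).

Lemma fps_decomp f :
  f = f 0%MM *: 1 + \sum_i fpsX i * fps_tail i f.
Proof.
have coef_sum (h : 'I_n -> fps n R) mu : (\sum_i h i) mu = \sum_i h i mu.
  by apply: (big_morph (fun g : fps n R => g mu)).
apply/fpsP => mu.
transitivity (f 0%MM * (mu == 0%MM)%:R
              + (\sum_i fpsX i * fps_tail i f) mu) => //.
rewrite coef_sum.
have E i : (fpsX i * fps_tail i f) mu =
    if [pick l | mu l != 0%N] == Some i then f mu else 0.
  rewrite coef_fpsXM; case: (eqVneq (mu i) 0%N) => [mui0|mui0] /=.
    by case: pickP => // l mul; case: eqP => // -[E]; rewrite E mui0 in mul.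
  by rewrite submK // lep1mP.
rewrite (eq_bigr _ (fun i _ => E i)) {E}; case: pickP => [l mul|mu0].
  rewrite (bigD1 l) //= eqxx big1 ?addr0 => [|i /negPf il].
    case: (eqVneq mu 0%MM) => [mu0|_]; first by rewrite mu0 mnm0E in mul.
    by rewrite mulr0 add0r.
  by rewrite (inj_eq Some_inj) eq_sym il.
have -> : mu = 0%MM.
  by apply/mnmP => i; rewrite mnm0E; apply/eqP; move: (mu0 i) => /= /negbFE.
by rewrite eqxx mulr1 big1 ?addr0.
Qed.

(** The inverse is the geometric series in a x_i, whose monomials are the
    powers of x_i alone. *)
Lemma geometric_inverse (a : R) i :
  exists g, (1 - a *: fpsX i) * g = 1.
Proof.
pose g : fps n R :=
  Fps (fun mu => if mu == (U_(i) *+ mu i)%MM then a ^+ mu i else 0).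
exists g; rewrite mulrBl mul1r -scalerAl; apply/eqP; rewrite subr_eq; apply/eqP.
(* It remains to compare coefficients in g = 1 + a x_i g. *)
apply/fpsP => mu.
transitivity ((mu == 0%MM)%:R + a * (fpsX i * g) mu) => //.
rewrite coef_fpsXM; case: (eqVneq (mu i) 0%N) => [mui0|mui0].
  by rewrite mulr0 addr0 /= mui0 mulm0n; case: eqP.
have Emu : mu = (U_(i) + (mu - U_(i)))%MM.
  by rewrite addmC submK // lep1mP.
case: (eqVneq mu 0%MM) => [mu0|_]; first by rewrite mu0 mnm0E in mui0.
rewrite add0r Emu; set nu := (mu - _)%MM.
rewrite addmC addmK /=.
rewrite mnmDE mnm1E eqxx addn1 mulmSr (can_eq (addmK _)).
by case: ifP => _; rewrite ?mulr0 // exprS.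
Qed.

End PowerSeriesVariables.

Section JetCoefficients.
Variables (n : nat) (k : comNzRingType) (m : nat).
Implicit Types (f g : fps n k) (i : 'I_n).

HB.instance Definition _ j := GRing.isZmodMorphism.Build
  (fps n k) {mpoly k[n * m]} (jetD m j) (@jetDB n k m j).

Lemma jetD_const j (c : k) :
  jetD m j (c *: (1 : fps n k)) = if j == 0%N then c%:MP else 0.
Proof.
rewrite /jetD /jet_eval.
suff -> : fps_trunc m.+1 (c *: (1 : fps n k)) = c%:MP.
  by rewrite mmapC /= coefC.
apply/mpolyP => mu; rewrite mcoeff_trunc mcoeffC /=.
by case: (eqVneq mu 0%MM) => [->|_]; rewrite ?mdeg0 // mulr0 if_same.
Qed.

Lemma jetD_X j i : (0 < m)%N -> jetD m j (fpsX k i) = (jet_arc k m i)`_j.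
Proof.
move=> m_gt0; rewrite /jetD /jet_eval.
suff -> : fps_trunc m.+1 (fpsX k i) = 'X_i by rewrite mmapX mmap1U.
apply/mpolyP => mu; rewrite mcoeff_trunc mcoeffX /= eq_sym.
by case: eqP => [<-|_]; rewrite ?mdeg1 ?ltnS ?m_gt0 // if_same.
Qed.

Lemma coef_jet_arc0 i : (jet_arc k m i)`_0 = 0.
Proof. by rewrite coef_sum big1 // => l _; rewrite coefZ coefXn mulr0. Qed.

Lemma coef_jet_arcS i (j : 'I_m) : (jet_arc k m i)`_j.+1 = jet_var k i j.
Proof.
rewrite coef_sum (bigD1 j) //= coefZ coefXn eqxx mulr1 big1 ?addr0 // => l lj.
by rewrite coefZ coefXn eqSS eq_sym (negPf (lj : val l != j)) mulr0.
Qed.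

Lemma jetD_order0 f : (0 < m)%N -> f 0%MM = 0 -> jetD m 0 f = 0.
Proof.
move=> m_gt0 f0; rewrite (fps_decomp f) f0 scale0r add0r raddf_sum /=.
apply: big1 => i _.
by rewrite jetDM // big_ord1 jetD_X // coef_jet_arc0 mul0r.
Qed.

End JetCoefficients.

(** Every algebra endomorphism of a power series ring over a field is local.
    Otherwise, with c the nonzero constant term of phi x_i, the unit
    1 - x_i / c would have an image in the kernel of D_0, a multiplicative map
    with D_0 1 = 1. *)
Lemma endo_fpsX_const n (k : fieldType)
    (phi : {lrmorphism fps n k -> fps n k}) (i : 'I_n) :
  phi (fpsX k i) 0%MM = 0.
Proof.
set c := (_ 0%MM); case: (eqVneq c 0) => // c_neq0.
have [g /(congr1 phi)] := geometric_inverse c^-1 i.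
rewrite rmorphM rmorphB !rmorph1 /= linearZ /= => /(congr1 (jetD 1 0)).
rewrite jetDM // big_ord1 [X in X * _]jetD_order0 ?mul0r //.
  have := @jetD_const n k 1 0 1; rewrite scale1r => -> /eqP.
  by rewrite eq_sym mpolyC_eq0 oner_eq0.
by rewrite /= -/c eqxx mulVf // subrr.
Qed.

Section InducedJetMap.
Variables (n : nat) (k : fieldType) (m : nat).
Hypothesis m_gt0 : (0 < m)%N.
Variable phi : {lrmorphism fps n k -> fps n k}.

(** Substitution of D_j (phi x_i) for x_i^(j): the action of phi on arcs
    through the origin. The matrix and [mxvec] follow the enumeration of the
    variables of the jet ring by [mxvec_index]. *)
Definition jet_map : jet_ring n k m -> jet_ring n k m :=
  mmap (@mpolyC (n * m) k)
    (mxvec (\matrix_(i < n, j < m) jetD m j.+1 (phi (fpsX k i))) 0).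

HB.instance Definition _ := GRing.RMorphism.copy jet_map
  (mmap (@mpolyC (n * m) k)
    (mxvec (\matrix_(i < n, j < m) jetD m j.+1 (phi (fpsX k i))) 0)).

(** For j > 0 this is the definition of [jet_map]; for j = 0 it expresses that
    phi preserves arcs through the origin. *)
Lemma jet_mapX j i : (j <= m)%N ->
  jet_map (jetD m j (fpsX k i)) = jetD m j (phi (fpsX k i)).
Proof.
rewrite jetD_X //; case: j => [|j] jm.
  by rewrite coef_jet_arc0 rmorph0 jetD_order0 // endo_fpsX_const.
rewrite (coef_jet_arcS _ _ (Ordinal jm)) /jet_map mmapX mmap1U mxvecE.
by rewrite mxE.
Qed.

(** Jet coefficients are natural in phi. The induction on j quantifies over all
    series: in the Leibniz expansion of D_j (x_i g_i) the term with D_j g_i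
    has the factor D_0 x_i = 0, so the induction hypothesis applies to all the
    terms that remain, on the side of g as on that of phi g. *)
Lemma jet_mapD j g : (j <= m)%N -> jet_map (jetD m j g) = jetD m j (phi g).
Proof.
elim/ltn_ind: j g => j IH g jm; rewrite [in RHS](fps_decomp g) {1}(fps_decomp g).
rewrite [phi _]rmorphD /= linearZ rmorph1 rmorph_sum !raddfD /= !raddf_sum /=.
congr (_ + _).
  rewrite !jetD_const; case: ifP => _; last exact: rmorph0.
  by rewrite /jet_map mmapC.
apply: eq_bigr => i _; rewrite rmorphM !jetDM // rmorph_sum.
apply: eq_bigr => l _; rewrite rmorphM /= jet_mapX; last first.
  by rewrite (leq_trans _ jm) // -ltnS.
case: (posnP l) => [l0|l_gt0].
  by rewrite l0 (jetD_order0 m_gt0 (endo_fpsX_const phi i)) !mul0r.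
rewrite IH ?(leq_trans (leq_subr _ _)) // ltn_subrL l_gt0.
by rewrite (leq_trans l_gt0) // -ltnS.
Qed.

(** The ring morphism [jet_map] sends a relation that puts a power of D_j f in
    the jet ideal of I to one for D_j (phi f) and J. *)
Lemma jsc_endo (I J : {pred fps n k}) :
    {in I, forall f, phi f \in J} ->
  {in jsc m I, forall f, phi f \in jsc m J}.
Proof.
move=> IJ f /asboolP fI; apply/asboolP => j jm; rewrite -jet_mapD //.
have /asboolP[e /asboolP[s sI E]] := fI j jm; apply/asboolP; exists e.
rewrite -rmorphXn E rmorph_sum; apply/asboolP.
exists [seq (jet_map c.1, jet_map c.2) | c <- s].
  move=> _ /mapP[c /sI [g [i [gI im ->]]] ->] /=.
  by exists (phi g), i; split; rewrite ?jet_mapD //; apply: IJ.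
by rewrite big_map; apply: eq_bigr => c _; rewrite rmorphM.
Qed.

End InducedJetMap.

Lemma lrmorphism_inverse (K : comNzRingType) (A B : algType K)
    (phi : {lrmorphism A -> B}) : bijective phi ->
  exists phi' : {lrmorphism B -> A}, cancel phi phi' /\ cancel phi' phi.
Proof.
case=> h phiK hK.
pose ha := GRing.isZmodMorphism.Build B A h (can2_zmod_morphism phiK hK).
pose hm := GRing.isMonoidMorphism.Build B A h (can2_monoid_morphism phiK hK).
pose hs := GRing.isScalable.Build K B A *:%R h (can2_scalable phiK hK).
pose hL : {lrmorphism B -> A} := HB.pack h ha hm hs.
by exists hL.
Qed.

Section QuotientMap.
Variables (K : comNzRingType) (A : comAlgType K) (I J : idealType A).
Variable phi : {lrmorphism A -> A}.
Hypothesis IJ : {in I : {pred A}, forall f, phi f \in (J : {pred A})}.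

Definition quot_map (x : quot_alg I) : quot_alg J := quot_pi J (phi (repr x)).

Lemma quot_mapE f : quot_map (quot_pi I f) = quot_pi J (phi f).
Proof.
apply/quot_algP; rewrite -rmorphB; apply: IJ; apply/quot_algP.
exact: quot_reprK.
Qed.

Fact quot_map_zmod_morphism : zmod_morphism quot_map.
Proof.
move=> x y; rewrite -(quot_reprK x) -(quot_reprK y) -quot_piB !quot_mapE.
by rewrite rmorphB quot_piB.
Qed.

Fact quot_map_monoid_morphism : monoid_morphism quot_map.
Proof.
split=> [|x y]; first by rewrite -[1]/(quot_pi I 1) quot_mapE !rmorph1.
rewrite -(quot_reprK x) -(quot_reprK y) -rmorphM !quot_mapE.
by rewrite !rmorphM.
Qed.

HB.instance Definition _ := GRing.isZmodMorphism.Build _ _ quot_map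
  quot_map_zmod_morphism.
HB.instance Definition _ := GRing.isMonoidMorphism.Build _ _ quot_map
  quot_map_monoid_morphism.

(** This packaging records the hypothesis phi(I) <= J, which cannot be inferred
    from [quot_map] alone. *)
Definition quot_rmorphism : {rmorphism quot_alg I -> quot_alg J} := quot_map.

Lemma quot_map_scalable : scalable quot_map.
Proof.
by move=> c x; rewrite -(quot_reprK x) -linearZ !quot_mapE !linearZ.
Qed.

End QuotientMap.

Theorem proposition4p1 (k : closedFieldType) (n : nat)
    (k_char0 : [pchar k] =i pred0)
    (I J : idealType (fps n k))
    (phi : {lrmorphism fps n k -> fps n k}) (phi_bij : bijective phi)
    (phi_IJ : forall g, g \in J <-> exists2 f, f \in I & phi f = g)
    (m : nat) (m_ge1 : (1 <= m)%N) :
  exists psi : {rmorphism quot_alg (jsc m I) -> quot_alg (jsc m J)},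
    [/\ bijective psi,
        scalable psi
      & forall f : fps n k,
          psi (quot_pi (jsc m I) f) = quot_pi (jsc m J) (phi f)].
Proof.
have [phi' [phiK phi'K]] := lrmorphism_inverse phi_bij.
have IJ : {in jsc m I, forall f, phi f \in jsc m J}.
  by apply: jsc_endo => // f fI; apply/phi_IJ; exists f.
have JI : {in jsc m J, forall f, phi' f \in jsc m I}.
  by apply: jsc_endo => // g /phi_IJ[f fI <-]; rewrite phiK.
exists (quot_rmorphism IJ); split; first exists (quot_rmorphism JI).
- by move=> x; rewrite -(quot_reprK x) /= (quot_mapE IJ) (quot_mapE JI) phiK.
- by move=> x; rewrite -(quot_reprK x) /= (quot_mapE JI) (quot_mapE IJ) phi'K.
- exact: (quot_map_scalable IJ).
- by move=> f; exact: (quot_mapE IJ).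
Qed.
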